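(* Let $H\in(0,\tfrac12)$, $x_0\in\mathbb{R}$ and $\theta>0$, and let $X$ be the fractional Ornstein--Uhlenbeck process with parameters $H,\theta,x_0$. Then for any $m\in\mathbb{N}$ with $m>1$ the estimator $$\widehat{\theta}_n(m)=\frac{\sum_{k=0}^{n^m-1}X_{k/n}\,\bigl(X_{(k+1)/n}-X_{k/n}\bigr)}{\frac1n\sum_{k=0}^{n^m-1}X_{k/n}^2}$$ is strongly consistent, i.e. $\widehat{\theta}_n(m)\to\theta$ almost surely as $n\to\infty$.
   Context: On a complete probability space, $B^H=\{B^H_t,\ t\ge 0\}$ is a fractional Brownian motion with Hurst index $H\in(0,\frac12)$: the centered Gaussian process with covariance $\mathbf{E}B^H_tB^H_s=\frac12\left(s^{2H}+t^{2H}-|t-s|^{2H}\right)$, taken in its continuous modification. The fractional Ornstein--Uhlenbeck process $X$ with drift parameter $\theta$ and (nonrandom) initial value $x_0$ is the unique solution of $X_t=x_0+\theta\int_0^tX_s\,ds+B^H_t$, $t\ge0$, explicitly $X_t=x_0e^{\theta t}+\theta e^{\theta t}\int_0^te^{-\theta s}B^H_s\,ds+B^H_t$. *)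

(* Defs.v *)
From HB Require Import structures.
From mathcomp Require Import all_boot all_order all_algebra.
From mathcomp Require Import all_classical all_reals all_analysis.

Set Implicit Arguments.
Unset Strict Implicit.
Unset Printing Implicit Defensive.

Import Order.TTheory GRing.Theory Num.Theory.
Import numFieldNormedType.Exports.

Local Open Scope classical_set_scope.
Local Open Scope ring_scope.

(* Processes are indexed by all of [R]; only times [t >= 0] are ever used. *)

(* [normal_prob m 0] is a junk (uniform) law in the library, so the degenerate
   normal law with variance 0 is the Dirac mass at the mean. *)
Definition gaussian_rv d (T : measurableType d) (R : realType)
    (P : probability T R) (Y : T -> R) : Prop :=
  exists m s : R, forall A : set R, measurable A ->
    P (Y @^-1` A) = if s == 0 then \d_m A else normal_prob m s A.

Definition gaussian_process d (T : measurableType d) (R : realType)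
    (P : probability T R) (B : R -> {RV P >-> R}) : Prop :=
  forall (n : nat) (t a : 'I_n -> R), (forall i, 0 <= t i) ->
    gaussian_rv P (fun w => \sum_(i < n) a i * B (t i) w).
Arguments gaussian_process {d T R} P B.

Record is_fBm d (T : measurableType d) (R : realType) (P : probability T R)
    (H : R) (B : R -> {RV P >-> R}) : Prop := IsFBm {
  fBm_gaussian : gaussian_process P B ;
  fBm_centered : forall t, 0 <= t -> ('E_P[B t] = 0)%E ;
  fBm_cov : forall s t, 0 <= s -> 0 <= t ->
    ('E_P[fun w => (B t w * B s w)%R])%E =
      (2^-1 * (s `^ (2 * H) + t `^ (2 * H) - `|t - s| `^ (2 * H)))%:E ;
  fBm_continuous :
    {ae P, forall w, {within `[0, +oo[, continuous (fun t => B t w)}} }.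
Arguments is_fBm {d T R} P H B.

(* Continuity of the paths of [X] is not required: it follows from the
   equation and the continuity of the paths of [B]. *)
Definition is_fOU d (T : measurableType d) (R : realType) (P : probability T R)
    (theta x0 : R) (B X : R -> {RV P >-> R}) : Prop :=
  {ae P, forall w, forall t, 0 <= t ->
    lebesgue_measure.-integrable `[0, t] (EFin \o (fun s => X s w)) /\
    X t w = x0 + theta * \int[lebesgue_measure]_(s in `[0, t]) X s w + B t w}.
Arguments is_fOU {d T R} P theta x0 B X.

(* For [x] the observed path. *)
Definition theta_hat (R : realType) (m n : nat) (x : R -> R) : R :=
  (\sum_(0 <= k < n ^ m)
      x (k%:R / n%:R) * (x (k.+1%:R / n%:R) - x (k%:R / n%:R)))
  / (n%:R^-1 * \sum_(0 <= k < n ^ m) x (k%:R / n%:R) ^+ 2).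

(* Main.v *)
Require Import Defs.
From mathcomp Require Import all_boot all_order all_algebra.
From mathcomp Require Import all_classical all_reals all_analysis.
From mathcomp Require Import measurable_realfun.
From mathcomp Require Import zify ring lra.

Set Implicit Arguments.
Unset Strict Implicit.
Unset Printing Implicit Defensive.

Import Order.TTheory GRing.Theory Num.Theory.
Import numFieldNormedType.Exports.

Local Open Scope classical_set_scope.
Local Open Scope ring_scope.

(** With q = exp(theta/n) and eps_k = X_((k+1)/n) - q X_(k/n), the estimator
    equals n (q - 1) + n (sum_k X_(k/n) eps_k) / (sum_k X_(k/n)^2).  The first
    term tends to theta.  As theta > 0 the process explodes: the denominator is
    at least the square of its last term, at a time of order n^(m-1) >= n, and
    that square grows like exp(2 theta n^(m-1)), whereas every eps_k with
    k < n^m is at most polynomial in n.  So the second term vanishes, and the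
    margin between the exponential and the polynomial is so large that crude
    estimates suffice ([theta_hat_cvg]), each failing with probability
    O(n^-2); Borel-Cantelli ([borel_cantelli]) then makes them hold eventually
    on almost every path.

    Both estimates concern V = X - B.  Since V' = theta (V + B), the difference
    V_c - exp(theta (c - a)) V_a is the integral of theta exp(theta (c - s)) B_s
    over [a, c], a pathwise limit of left Riemann sums ([ou_drift_riemann]).
    These are finite linear combinations of values of B with nonnegative
    weights, hence centred Gaussian with a second moment given by the
    covariance, and bounds that are uniform in the mesh pass to the limit
    ([outer_le_liminf]).

    Upper bound: the covariance is at most 1 + c on [0, c], so Markov's
    inequality and a union bound over the n^m grid points control the eps_k
    ([drift_outer_le], [fBm_outer_le]).

    Lower bound: the covariance dominates a positive product kernel g(s) g(t)
    ([fBm_cov_fun_ge]), so the Riemann sums for V_t have a standard deviation of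
    order at least exp(theta t).  A Gaussian density is at most the inverse of
    its standard deviation ([gaussian_small_ball]), and therefore |V_t| < mu has
    probability O(mu exp(- theta t)) ([drift_small_ball]), which is summable
    along the observation horizons even for mu polynomial in n. *)

(** * Riemann sums and antiderivatives *)

(** Heine's theorem: at each point of the segment continuity gives a radius,
    and the covering form of compactness makes one radius serve for all. *)
Lemma uniform_continuity_segment (R : realType) (f : R -> R) (a c e : R) :
  continuous f -> 0 < e ->
  exists2 d, 0 < d & forall x y, a <= x <= c -> `|x - y| < d -> `|f x - f y| < e.
Proof.
move=> cf e0.
have /compact_near_coveringP cov := @segment_compact R a c.
have := cov R (0:R)^'+ (fun d x => forall y, `|x - y| < d -> `|f x - f y| < e) _ _.
case.
- move=> x _.
  have /cvgrPdist_lt /(_ (e / 2)) := cf x.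
  rewrite divr_gt0// => /(_ isT) /nbhs_ballP[r /= r0 hr].
  near=> x' d => y /= xy.
  have h1 : `|x - x'| < r / 2.
    near: x'. apply: nbhsx_ballx. by rewrite divr_gt0.
  have h2 : d < r / 2.
    near: d. apply: nbhs_right_lt. by rewrite divr_gt0.
  have hx' : `|f x - f x'| < e / 2 by apply: hr; rewrite /ball/=; lra.
  have hy : `|f x - f y| < e / 2.
    apply: hr; rewrite /ball/=.
    by have := ler_distD x' x y; lra.
  have := ler_distD (f x) (f x') (f y); rewrite (distrC (f x') (f x)); lra.
- move=> d /= d0 hd; exists (d / 2); first by rewrite divr_gt0.
  move=> x y xac xy; apply: (hd (d / 2)) => //=; last by rewrite divr_gt0.
  by rewrite sub0r normrN gtr0_norm ?divr_gt0//; lra.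
Unshelve. all: by end_near. Qed.

(** There are [j.+1] cells, so that the mesh is meaningful for every [j]. *)
Definition left_riemann {R : realType} (f : R -> R) (a c : R) (j : nat) : R :=
  \sum_(i < j.+1) (c - a) / j.+1%:R * f (a + i%:R * ((c - a) / j.+1%:R)).

(** By the mean value theorem the increment of [F] over a cell is the mesh times
    a value of [f] inside the cell, which uniform continuity compares with the
    value at the left end. *)
Lemma left_riemann_cvg (R : realType) (f F : R -> R) (a c : R) :
  a < c -> continuous f -> {within `[a, c], continuous F} ->
  (forall s, a < s < c -> is_derive s 1 F (f s)) ->
  left_riemann f a c j @[j --> \oo] --> F c - F a.
Proof.
move=> ac cf cF dF; apply/cvgrPdist_le => /= e e0.
have ca0 : 0 < c - a by rewrite subr_gt0.
have [d d0 hd] := @uniform_continuity_segment R f a c _ cf (divr_gt0 e0 ca0).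
have [J _ hJ] : \forall j \near \oo, (c - a) / d < j%:R by exact: nbhs_infty_gtr.
exists J => // j /= Jj.
set h := (c - a) / j.+1%:R.
have j0 : 0 < j.+1%:R :> R by rewrite ltr0n.
have h0 : 0 < h by rewrite divr_gt0.
have hd' : h < d.
  rewrite /h ltr_pdivrMr// mulrC -ltr_pdivrMr//.
  by apply: (lt_le_trans (hJ _ Jj)); rewrite ler_nat.
have jh : j.+1%:R * h = c - a by rewrite /h mulrC divfK// gt_eqF.
pose s i := a + i%:R * h.
have sS i : s i.+1 = s i + h by rewrite /s -natr1; ring.
have sac i : (i <= j.+1)%N -> a <= s i <= c.
  move=> ij; rewrite lerDl mulr_ge0 ?ler0n ?(ltW h0)//=.
  rewrite /s -lerBrDl -jh ler_pM2r// ler_nat//.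
have tel : F c - F a = \sum_(i < j.+1) (F (s i.+1) - F (s i)).
  rewrite -(big_mkord xpredT (fun i => F (s i.+1) - F (s i))).
  rewrite (telescope_sumr (fun i => F (s i)))// /s jh mul0r addr0.
  by congr (F _ - _); ring.
rewrite tel /left_riemann -/h -sumrB.
apply: (le_trans (ler_norm_sum _ _ _)).
have -> : e = \sum_(i < j.+1) h * (e / (c - a)).
  rewrite sumr_const card_ord -[RHS]mulr_natl mulrA jh.
  by rewrite mulrC divfK// gt_eqF.
apply: ler_sum => i _.
have /andP[asi sic] := sac i (ltnW (ltn_ord i)).
have /andP[asi1 si1c] := sac i.+1 (ltn_ord i).
have ss : s i < s i.+1 by rewrite sS ltrDl.
have [x + ->] : exists2 x, x \in `]s i, s i.+1[%R &
    F (s i.+1) - F (s i) = f x * (s i.+1 - s i).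
  apply: (@MVT R F f (s i) (s i.+1) ss).
  - move=> x; rewrite in_itv/= => /andP[x1 x2]; apply: dF.
    by apply/andP; split; lra.
  - apply: continuous_subspaceW cF => x /=; rewrite !in_itv/= => /andP[x1 x2].
    by apply/andP; split; lra.
rewrite in_itv/= => /andP[x1 x2].
have -> : s i.+1 - s i = h by rewrite sS; ring.
rewrite -/(s i) [f x * h]mulrC -mulrBr normrM gtr0_norm// ler_pM2l//.
apply/ltW/hd; first by apply/andP; split; lra.
by rewrite gtr0_norm; rewrite sS in x2; lra.
Qed.

(** * The drift of the equation along a path *)

(** Paths of [B] are continuous on the closed half-line only; reflecting them
    gives a function continuous on the whole line with the same values at
    nonnegative times. *)
Lemma continuous_even_extension (R : realType) (b : R -> R) :
  {within `[0, +oo[, continuous b} -> continuous (fun s : R => b `|s|).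
Proof.
move=> /subspace_continuousP cb s.
apply: (@cvg_comp _ _ _ (fun s : R => `|s|) b _ (within `[0, +oo[ (nbhs `|s|))).
  move=> U /=; rewrite nbhs_simpl /within /= => hU.
  have := @norm_continuous _ _ s _ hU; rewrite nbhs_simpl /=.
  by apply: filterS => x; apply; rewrite /= in_itv/= andbT.
by apply: cb; rewrite /= in_itv/= andbT.
Qed.

Lemma is_derive_expR_decay (R : realType) (theta c s : R) :
  is_derive s 1 (fun s : R => expR (theta * (c - s))) (- theta * expR (theta * (c - s))).
Proof.
have -> : (fun s : R => expR (theta * (c - s))) =
    expR \o (fun s : R => (cst (theta * c) - (theta \*: id)) s).
  by apply/funext => y /=; rewrite mulrBr.
by apply: is_derive_eq; rewrite sub0r [theta *: 1]mulr1 mulr1 mulrC mulrBr.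
Qed.

Definition ou_path {R : realType} (theta x0 : R) (x b : R -> R) : Prop :=
  {within `[0, +oo[, continuous b} /\
  forall t, 0 <= t ->
    lebesgue_measure.-integrable `[0, t] (EFin \o x) /\
    x t = x0 + theta * \int[lebesgue_measure]_(s in `[0, t]) x s + b t.

Lemma ou_path_start (R : realType) (theta x0 : R) (x b : R -> R) :
  ou_path theta x0 x b -> x 0 - b 0 = x0.
Proof.
move=> [_ /(_ 0 (lexx _))[_ ->]].
by rewrite set_itv1 Rintegral_set1 mulr0 addr0 addrK.
Qed.

(** [V = x - b] satisfies [V' = theta * (V + b)], so the derivative of
    [expR (theta * (c - s)) * V s] in [s] is [theta * expR (theta * (c - s)) * b s]:
    the drift is an integral of the noise alone. *)
Lemma ou_drift_riemann (R : realType) (theta x0 : R) (x b : R -> R) (a c : R) :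
  ou_path theta x0 x b -> 0 <= a -> a < c ->
  left_riemann (fun s : R => theta * expR (theta * (c - s)) * b `|s|) a c j
    @[j --> \oo] --> (x c - b c) - expR (theta * (c - a)) * (x a - b a).
Proof.
move=> [cb hx] a0 ac.
have cbn := continuous_even_extension cb.
pose V t := x0 + theta * \int[lebesgue_measure]_(s in `[0, t]) x s.
have xV t : 0 <= t -> x t = V t + b t by move=> /hx[_ ->].
have c0 : 0 < c by lra.
have cV : {within `[0, c + 1], continuous V}.
  apply: within_continuousD; first by move=> ?; exact: cvg_cst.
  move=> t; apply: cvgM; first exact: cvg_cst.
  apply: (@parameterized_integral_continuous R 0 (c + 1) x); first lra.
  by apply: (hx _ _).1; lra.
(* The equation improves regularity step by step: the integral is continuous in
   its upper bound, hence so is x, hence the integral is differentiable. *)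
have cx s : 0 < s < c + 1 -> {for s, continuous x}.
  move=> /andP[s0 sc].
  have h : {for s, continuous (V + (fun s : R => b `|s|))}.
    apply: continuousD; last exact: cbn.
    apply: within_continuous_continuous cV _; first lra.
    by rewrite in_itv/= s0.
  have ev : \forall t \near s, x t = (V + (fun s : R => b `|s|)) t.
    near=> t.
    have t0 : 0 < t by near: t; exact: lt_nbhsr.
    by rewrite xV ?(ltW t0)//; congr (_ + b _); rewrite gtr0_norm.
  have h2 : x @ s --> (V + (fun s : R => b `|s|)) s.
    by apply: cvg_trans h; apply: near_eq_cvg; apply: filterS ev => t ->.
  by move: h2; rewrite -(nbhs_singleton ev); exact.
have dV s : 0 < s < c + 1 -> is_derive s 1 V (theta * x s).
  move=> /andP[s0 sc].
  have [d1 d2] := @continuous_FTC1_closed R x 0 s (c + 1) sc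
    ((hx (c + 1) ltac:(lra)).1) s0 (cx s ltac:(apply/andP; split; lra)).
  rewrite /V; apply: is_derive_eq; first exact: (is_deriveD _ (is_deriveM _ (derivableP d1))).
  by rewrite -derive1E d2 scaler0 add0r addr0.
have -> : (x c - b c) - expR (theta * (c - a)) * (x a - b a) =
    expR (theta * (c - c)) * V c - expR (theta * (c - a)) * V a.
  by rewrite subrr mulr0 expR0 mul1r !xV ?addrK//; lra.
apply: (@left_riemann_cvg R _ (fun s : R => expR (theta * (c - s)) * V s)) => //.
- move=> s; apply: cvgM; last exact: cbn.
  apply: cvgM; first exact: cvg_cst.
  apply: continuous_comp; last exact: continuous_expR.
  by apply: cvgM; [exact: cvg_cst|apply: cvgB; [exact: cvg_cst|exact: cvg_id]].
- have cE : {within `[a, c], continuous (fun s : R => expR (theta * (c - s)))}.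
    apply: continuous_subspaceT => s.
    apply: continuous_comp; last exact: continuous_expR.
    by apply: cvgM; [exact: cvg_cst|apply: cvgB; [exact: cvg_cst|exact: cvg_id]].
  have cV' : {within `[a, c], continuous V}.
    apply: continuous_subspaceW cV => t /=; rewrite !in_itv/= => /andP[? ?].
    by apply/andP; split; lra.
  by move=> t; apply: cvgM; [exact: cE|exact: cV'].
- move=> s /andP[sa sc].
  have hs : 0 < s < c + 1 by apply/andP; split; lra.
  apply: (is_derive_eq (is_deriveM (is_derive_expR_decay theta c s) (dV s hs))).
  rewrite /GRing.scale/= gtr0_norm ?xV; [ring|lra|lra].
Unshelve. all: by end_near. Qed.

(** * The least squares ratio *)

(** A single Taylor term, that of degree [p.+1], is already enough. *)
Lemma exp_dominates_poly (R : realType) (a C : R) (p : nat) : 0 < a ->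
  \forall n \near \oo, C * n%:R ^+ p <= expR (a * n%:R).
Proof.
move=> a0; have ap0 : 0 < a ^+ p.+1 / p.+1`!%:R.
  by rewrite divr_gt0 ?exprn_gt0// ltr0n fact_gt0.
near=> n.
have hn : C / (a ^+ p.+1 / p.+1`!%:R) < n%:R by near: n; exact: nbhs_infty_gtr.
apply: le_trans (expR_ge1Dxn p _); last by rewrite mulr_ge0 ?ler0n ?ltW.
have hC : C <= a ^+ p.+1 / p.+1`!%:R * n%:R.
  by rewrite mulrC -ler_pdivrMr// ltW.
have := ler_wpM2r (exprn_ge0 p (ler0n R n)) hC.
have -> : (a * n%:R) ^+ p.+1 / p.+1`!%:R =
    a ^+ p.+1 / p.+1`!%:R * n%:R * n%:R ^+ p.
  by rewrite exprMn [n%:R ^+ p.+1]exprS; ring.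
lra.
Unshelve. all: by end_near. Qed.

(** With [h = theta / n], the inequality [1 + u <= expR u] at [u = h] and at
    [u = - h] squeezes the sequence between [theta] and [theta * expR h]. *)
Lemma scaled_expR_cvg (R : realType) (theta : R) : 0 < theta ->
  n%:R * (expR (theta / n%:R) - 1) @[n --> \oo] --> theta.
Proof.
move=> t0.
have c0 : theta / n%:R @[n --> \oo] --> (0 : R).
  rewrite -[X in _ --> X](mulr0 theta); apply: cvgM; first exact: cvg_cst.
  by rewrite -cvg_shiftS; exact: cvg_harmonic.
apply: (@squeeze_cvgr _ _ _ _ (fun=> theta) (fun n => theta * expR (theta / n%:R))).
- near=> n.
  have n0 : 0 < n%:R :> R by rewrite ltr0n; near: n; exact: nbhs_infty_gt.
  have nt : n%:R * (theta / n%:R) = theta by rewrite mulrC divfK// gt_eqF.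
  set h := theta / n%:R in nt *.
  have h1 := expR_ge1Dx h.
  have h2 : 1 - h <= (expR h)^-1 by rewrite -expRN; exact: expR_ge1Dx.
  have h3 : (1 - h) * expR h <= 1.
    by rewrite -ler_pdivlMr ?expR_gt0// div1r.
  rewrite -[X in X <= _ <= X * _]nt; apply/andP; split.
    by rewrite ler_pM2l//; lra.
  by rewrite -mulrA ler_pM2l//; lra.
- exact: cvg_cst.
- rewrite -[X in _ --> X]mulr1; apply: cvgM; first exact: cvg_cst.
  have : expR (theta / n%:R) @[n --> \oo] --> expR (0 : R).
    by apply: (cvg_comp _ _ c0); exact: continuous_expR.
  by rewrite expR0.
Unshelve. all: by end_near. Qed.

(** The error equals [n * (\sum_k y k * eps_k) / S] with
    [eps_k = y k.+1 - q * y k]; Young's inequality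
    [|u * v| <= eta * u ^+ 2 + v ^+ 2 / (4 * eta)] bounds it term by term. *)
Lemma regression_error (R : realType) (y : nat -> R) (q eta : R) (n N : nat) :
  (0 < n)%N -> 0 < eta ->
  let S := \sum_(0 <= k < N) y k ^+ 2 in
  let E := \sum_(0 <= k < N) (y k.+1 - q * y k) ^+ 2 in
  0 < S ->
  `|(\sum_(0 <= k < N) y k * (y k.+1 - y k)) / (n%:R^-1 * S) - n%:R * (q - 1)|
    <= n%:R * (eta + E / (4 * eta * S)).
Proof.
move=> n0 eta0 S E S0.
have n0' : 0 < n%:R :> R by rewrite ltr0n.
have -> : \sum_(0 <= k < N) y k * (y k.+1 - y k) =
    (q - 1) * S + \sum_(0 <= k < N) y k * (y k.+1 - q * y k).
  rewrite mulr_sumr -big_split/=; apply: eq_bigr => k _; ring.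
set Z := \sum_(0 <= k < N) y k * (y k.+1 - q * y k).
have -> : ((q - 1) * S + Z) / (n%:R^-1 * S) - n%:R * (q - 1) = n%:R * (Z / S).
  by field; rewrite !gt_eqF.
rewrite normrM gtr0_norm// ler_pM2l// normrM (@gtr0_norm _ S^-1) ?invr_gt0//.
rewrite ler_pdivrMr//.
have -> : (eta + E / (4 * eta * S)) * S = eta * S + E / (4 * eta).
  by field; rewrite !gt_eqF.
rewrite mulr_sumr mulr_suml -big_split/=.
apply: (le_trans (ler_norm_sum _ _ _)); apply: ler_sum => k _.
set u := y k; set v := _ - _.
have eB : eta * u ^+ 2 + v ^+ 2 / (4 * eta) =
    ((2 * eta * u - v) ^+ 2 + 4 * eta * (u * v)) / (4 * eta).
  by field; rewrite gt_eqF.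
have eD : eta * u ^+ 2 + v ^+ 2 / (4 * eta) =
    ((2 * eta * u + v) ^+ 2 - 4 * eta * (u * v)) / (4 * eta).
  by field; rewrite gt_eqF.
have e0 : 0 < 4 * eta by rewrite mulr_gt0.
rewrite ler_norml; apply/andP; split.
  by rewrite lerNl eD ler_pdivlMr//; have := sqr_ge0 (2 * eta * u + v); lra.
by rewrite eB ler_pdivlMr//; have := sqr_ge0 (2 * eta * u - v); lra.
Qed.

(** The exponents are tuned to the error bound with [eta = n ^- 2]: a last
    observation of size [n ^ (2m + 3)] makes [S] exceed [n ^ 4] times the sum of
    the [n ^ m] squared innovations, and both error terms are then at most
    [1 / n]. *)
Lemma theta_hat_cvg (R : realType) (theta c : R) (m : nat) (x : R -> R) :
  0 < theta -> 0 < c ->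
  (\forall n \near \oo, forall k, (k < n ^ m)%N ->
    `|x (k.+1%:R / n%:R) - expR (theta / n%:R) * x (k%:R / n%:R)|
       <= c * n%:R ^+ m.+1) ->
  (\forall n \near \oo,
    c * n%:R ^+ (2 * m + 3) <= `|x ((n ^ m).-1%:R / n%:R)|) ->
  theta_hat m n x @[n --> \oo] --> theta.
Proof.
move=> t0 c0 Heps Hx.
have key : \forall n \near \oo,
    `|n%:R * (expR (theta / n%:R) - 1) - theta_hat m n x| <= 2 / n%:R.
  near=> n.
  have n0 : (0 < n)%N by near: n; exact: nbhs_infty_gt.
  have n0' : 0 < n%:R :> R by rewrite ltr0n.
  have he : forall k, (k < n ^ m)%N ->
    `|x (k.+1%:R / n%:R) - expR (theta / n%:R) * x (k%:R / n%:R)|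
       <= c * n%:R ^+ m.+1 by near: n; exact: Heps.
  have hx : c * n%:R ^+ (2 * m + 3) <= `|x ((n ^ m).-1%:R / n%:R)|.
    by near: n; exact: Hx.
  set N := (n ^ m)%N in he hx *.
  have N0 : (0 < N)%N by rewrite expn_gt0 n0.
  pose y k := x (k%:R / n%:R).
  set q := expR (theta / n%:R) in he *.
  pose S := \sum_(0 <= k < N) y k ^+ 2.
  pose E := \sum_(0 <= k < N) (y k.+1 - q * y k) ^+ 2.
  have S_ge : c ^+ 2 * n%:R ^+ (4 * m + 6) <= S.
    rewrite /S -(prednK N0) big_nat_recr//=.
    apply: (@le_trans _ _ (y N.-1 ^+ 2)).
      rewrite -[leRHS]real_normK ?num_real//.
      apply: (@le_trans _ _ ((c * n%:R ^+ (2 * m + 3)) ^+ 2)).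
        rewrite exprMn -exprM (_ : (4 * m + 6 = (2 * m + 3) * 2)%N)//; lia.
      by rewrite lerXn2r// ?nnegrE// mulr_ge0 ?exprn_ge0 ?ler0n ?ltW.
    by rewrite lerDr sumr_ge0// => k _; exact: sqr_ge0.
  have E_le : E <= n%:R ^+ m * (c ^+ 2 * n%:R ^+ (2 * m + 2)).
    apply: (@le_trans _ _ (\sum_(0 <= k < N) c ^+ 2 * n%:R ^+ (2 * m + 2))).
      rewrite /E !big_nat; apply: ler_sum => k /andP[_ kN].
      rewrite -[leLHS]real_normK ?num_real//.
      rewrite (_ : (2 * m + 2 = m.+1 * 2)%N); last lia.
      rewrite exprM -exprMn lerXn2r// ?nnegrE ?normr_ge0//.
        by rewrite mulr_ge0 ?exprn_ge0 ?ler0n ?ltW.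
      exact: he.
    by rewrite sumr_const_nat subn0 -[leLHS]mulr_natl natrX.
  have S0 : 0 < S.
    by apply: lt_le_trans S_ge; rewrite mulr_gt0 ?exprn_gt0.
  have := @regression_error R y q (n%:R ^- 2) n N n0 _ S0.
  rewrite invr_gt0 exprn_gt0// => /(_ isT).
  rewrite distrC -/E -/S => h; apply: le_trans h _.
  have -> : n%:R * (n%:R ^- 2 + E / (4 * n%:R ^- 2 * S)) =
      1 / n%:R + n%:R ^+ 3 * E / (4 * S).
    by field; rewrite !gt_eqF.
  suff h : n%:R ^+ 3 * E / (4 * S) <= 1 / n%:R.
    by have e2 : 2 / n%:R = 1 / n%:R + 1 / n%:R :> R; [ring|lra].
  rewrite ler_pdivrMr ?mulr_gt0// [leRHS]mulrAC mul1r ler_pdivlMr//.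
  have n1 : 1 <= n%:R :> R by rewrite ler1n.
  have h1 : n%:R ^+ 3 * E * n%:R <= c ^+ 2 * n%:R ^+ (3 * m + 6).
    have -> : n%:R ^+ 3 * E * n%:R = n%:R ^+ 4 * E by ring.
    apply: (le_trans (ler_wpM2l _ E_le)); first by rewrite exprn_ge0// ltW.
    by rewrite (_ : (3 * m + 6 = 4 + m + (2 * m + 2))%N) ?exprD; [lra|lia].
  have h2 : c ^+ 2 * n%:R ^+ (3 * m + 6) <= c ^+ 2 * n%:R ^+ (4 * m + 6).
    by rewrite ler_pM2l ?exprn_gt0// ler_weXn2l//; lia.
  lra.
apply/cvgrPdist_le => /= e e0.
have e2 : 0 < e / 2 by rewrite divr_gt0.
have /cvgrPdist_le/(_ _ e2) hc := scaled_expR_cvg t0.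
near=> n.
have h1 : `|theta - n%:R * (expR (theta / n%:R) - 1)| <= e / 2.
  by near: n; exact: hc.
have h2 : `|n%:R * (expR (theta / n%:R) - 1) - theta_hat m n x| <= 2 / n%:R.
  by near: n; exact: key.
have h3 : 2 / n%:R <= e / 2.
  have hn : 4 / e < n%:R by near: n; exact: nbhs_infty_gtr.
  have n0 : 0 < n%:R :> R by apply: lt_trans hn; rewrite divr_gt0.
  rewrite ler_pdivrMr//; move: hn; rewrite ltr_pdivrMr//; lra.
have := ler_distD (n%:R * (expR (theta / n%:R) - 1)) theta (theta_hat m n x).
lra.
Unshelve. all: by end_near. Qed.

(** * Outer probability *)

(** The events bounded below ask the whole path to satisfy the equation, so they
    need not be measurable. *)
Definition outer_le d (T : measurableType d) (R : realType)
    (P : probability T R) (A : set T) (e : R) : Prop :=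
  exists E, [/\ measurable E, A `<=` E & (P E <= e%:E)%E].

Lemma outer_leW d (T : measurableType d) (R : realType)
    (P : probability T R) (A : set T) (e e' : R) :
  e <= e' -> outer_le P A e -> outer_le P A e'.
Proof.
move=> ee [E [mE AE PE]]; exists E; split => //.
by apply: le_trans PE _; rewrite lee_fin.
Qed.

Lemma outer_leU d (T : measurableType d) (R : realType)
    (P : probability T R) (A A' : set T) (e e' : R) :
  outer_le P A e -> outer_le P A' e' -> outer_le P (A `|` A') (e + e').
Proof.
move=> [E [mE AE PE]] [E' [mE' AE' PE']]; exists (E `|` E'); split.
- exact: measurableU.
- exact: setUSS.
- have h := measureU2 P mE mE'.
  by apply: le_trans h _; rewrite EFinD leeD.
Qed.

Lemma outer_le_bigcup d (T : measurableType d) (R : realType)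
    (P : probability T R) (A : nat -> set T) (e : R) (N : nat) :
  (forall k, (k < N)%N -> outer_le P (A k) e) ->
  outer_le P (\bigcup_(k < N) A k) (N%:R * e).
Proof.
elim: N => [|N IH] h.
  exists set0; split => //; first by rewrite bigcup_mkord big_ord0.
  by rewrite measure0 mul0r.
rewrite bigcup_mkord big_ord_recr/= -bigcup_mkord -natr1 mulrDl mul1r.
apply: outer_leU; first by apply: IH => k kN; apply: h; rewrite ltnS ltnW.
exact: h.
Qed.

(** Fatou's lemma for sets.  It carries bounds from Riemann sums to their
    limit, for events defined by strict inequalities. *)
Lemma outer_le_liminf d (T : measurableType d) (R : realType)
    (P : probability T R) (A : set T) (E : nat -> set T) (e : R) :
  (forall j, measurable (E j)) ->
  (\forall j \near \oo, (P (E j) <= e%:E)%E) ->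
  (forall w, A w -> \forall j \near \oo, E j w) ->
  outer_le P A e.
Proof.
move=> mE [J _ hJ] AE.
pose F k := \bigcap_(j in [set j | (k <= j)%N]) E j.
have mF k : measurable (F k) by apply: bigcap_measurable => //; exists k => /=.
have mUF : measurable (\bigcup_k F k) by exact: bigcupT_measurable.
exists (\bigcup_k F k); split; first by [].
- by move=> w /AE[k _ hk]; exists k => // j /= kj; exact: hk.
- have ndF : nondecreasing_seq F.
  move=> k l kl; apply/subsetPset => w Fw j /= lj; apply: Fw => /=.
  exact: leq_trans kl lj.
have cvF := @nondecreasing_cvg_mu _ _ _ P F mF mUF ndF.
rewrite -(cvg_lim _ cvF)//; apply: lime_le; first by apply/cvg_ex; exists (P (\bigcup_k F k)).
apply: nearW => k /=; apply: le_trans (hJ (maxn k J) _); last exact: leq_maxr.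
apply: le_measure; rewrite ?inE// => w; apply => /=; exact: leq_maxl.
Qed.

(** The terms are dominated by those with [n0 = 0], and
    [(n + 1) ^- 2 <= 2 / (n + 1) - 2 / (n + 2)] telescopes. *)
Lemma sum_inv_sqr_le (R : realType) (n0 N : nat) :
  \sum_(0 <= n < N) (n0 + n).+1%:R ^- 2 <= 2 :> R.
Proof.
suff h : \sum_(0 <= n < N) (n0 + n).+1%:R ^- 2 <= 2 - 2 / N.+1%:R :> R.
  by apply: le_trans h _; rewrite gerBl mulr_ge0// invr_ge0.
elim: N => [|N IH]; first by rewrite big_geq// invr1; lra.
rewrite big_nat_recr//=.
have h1 : (n0 + N).+1%:R ^- 2 <= N.+1%:R ^- 2 :> R.
  rewrite lef_pV2 ?posrE ?exprn_gt0 ?ltr0n// lerXn2r ?nnegrE ?ler0n// ler_nat.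
  by rewrite ltnS leq_addl.
suff h2 : N.+1%:R ^- 2 <= 2 / N.+1%:R - 2 / N.+2%:R :> R.
  apply: le_trans (lerD IH (le_trans h1 h2)) _.
  by rewrite addrA subrK.
rewrite -[N.+2%:R]natr1.
have : 1 <= N.+1%:R :> R by rewrite ler1n.
set u := N.+1%:R => u1.
have -> : 2 / u - 2 / (u + 1) = 2 / (u * (u + 1)).
  by field; apply/andP; split; rewrite gt_eqF//; lra.
have u2 : 0 < u ^+ 2 by rewrite exprn_gt0//; lra.
rewrite ler_pdivlMr ?mulr_gt0//; [|lra..].
by rewrite mulrC ler_pdivrMr//; nra.
Qed.

Lemma borel_cantelli d (T : measurableType d) (R : realType)
    (P : probability T R) (A : nat -> set T) (C : R) :
  (\forall n \near \oo, outer_le P (A n) (C / n%:R ^+ 2)) ->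
  {ae P, forall w, \forall n \near \oo, ~ A n w}.
Proof.
move=> [n0 _ h].
have {}h n : outer_le P (A (n0 + n).+1) (C / (n0 + n).+1%:R ^+ 2).
  by apply: h => /=; rewrite -addnS leq_addr.
pose E n := projT1 (cid (h n)).
have hE n := projT2 (cid (h n)).
have mE n : measurable (E n) by case: (hE n).
have C0 : 0 <= C.
  have [_ _ /(le_trans (measure_ge0 _ _))] := hE 0%N.
  by rewrite lee_fin pmulr_lge0// invr_gt0 exprn_gt0.
have sumE : (\sum_(n <oo) P (E n) < +oo)%E.
  apply: (@le_lt_trans _ _ (C * 2)%:E); last exact: ltry.
  apply: lime_le; first exact: is_cvg_nneseries.
  apply: nearW => N.
  apply: (@le_trans _ _ (\sum_(0 <= n < N) (C / (n0 + n).+1%:R ^+ 2)%:E)%E).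
    by apply: lee_sum => n _; case: (hE n).
  rewrite sumEFin lee_fin -mulr_sumr ler_wpM2l//.
  exact: sum_inv_sqr_le.
have := lim_sup_set_cvg0 mE sumE => h0.
exists (lim_sup_set E); split => //.
  by apply: bigcap_measurable => // k _; exact: bigcup_measurable.
move=> w /= hw; apply: contrapT => hn; apply: hw.
have /existsNP[k hk] : ~ forall k, (\bigcup_(j >= k) E j) w.
  by move=> hk; apply: hn => k _; exact: hk.
exists (n0 + k).+1 => // n /= kn An; apply: hk.
exists (n - n0.+1)%N; first by rewrite /=; lia.
have [_ + _] := hE (n - n0.+1)%N; apply.
by rewrite (_ : (n0 + (n - n0.+1)).+1 = n)//; lia.
Qed.

(** * Small balls for Gaussian variables *)

(** The density is the Radon-Nikodym derivative, by uniqueness of the latter. *)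
Lemma integral_normal_prob (R : realType) (m s : R) (f : _ -> \bar R) :
  measurable_fun [set: R] f ->
  (\int[normal_prob m s]_x `|f x| < +oo)%E ->
  (\int[normal_prob m s]_x f x =
   \int[lebesgue_measure]_x (f x * (normal_pdf m s x)%:E))%E.
Proof.
move=> mf finf.
have dom := @normal_prob_dominates R m s.
rewrite -(Radon_Nikodym_change_of_variables dom)//=; last first.
  by apply/integrableP; split.
apply: ae_eq_integral => //.
- by apply: emeasurable_funM => //; apply: measurable_int; exact: Radon_Nikodym_integrable.
- apply: emeasurable_funM; first exact: mf.
  by apply/measurable_EFinP; exact: measurable_normal_pdf.
- apply: ae_eqe_mul2l => /=.
  rewrite Radon_NikodymE//=.
  case: cid => /= h [h1 h2 h3].
  apply: integral_ae_eq => //=.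
  + by apply/measurable_EFinP; exact: measurable_normal_pdf.
  + by move=> E _ mE; rewrite -h3.
Qed.

(** The constant 8 is not sharp: it comes from dominating the integrand by a
    multiple of the density with standard deviation [2 * s], through
    [u <= expR u]. *)
Lemma normal_second_moment_le (R : realType) (m s : R) : s != 0 ->
  (\int[lebesgue_measure]_x (((x - m) ^+ 2)%:E * (normal_pdf m s x)%:E)
    <= (8 * s ^+ 2)%:E)%E.
Proof.
move=> s0; have s20 : 2 * s != 0 by rewrite mulf_neq0.
have ss : 0 < s ^+ 2 by rewrite exprn_even_gt0.
apply: (@le_trans _ _
  (\int[lebesgue_measure]_x ((8 * s ^+ 2)%:E * (normal_pdf m (2 * s) x)%:E))%E).
  apply: ge0_le_integral => //.
  - by move=> x _; rewrite -EFinM lee_fin mulr_ge0 ?sqr_ge0 ?normal_pdf_ge0.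
  - apply/measurable_EFinP; apply: measurable_funM; last exact: measurable_normal_pdf.
    by apply: measurable_funX; apply: measurable_funB.
  - apply/measurable_EFinP; apply: measurable_funM => //; exact: measurable_normal_pdf.
  - move=> x _; rewrite -!EFinM lee_fin !normal_pdfE// /normal_fun.
    have -> : normal_peak (2 * s) = normal_peak s / 2.
      rewrite /normal_peak exprMn -mulrA -mulrnAr sqrtrM ?exprn_ge0//.
      by rewrite sqrtr_sqr ger0_norm// invfM mulrC -mulrnAr.
    have := normal_peak_gt0 s0; set p := normal_peak s => p0.
    set y := (x - m) ^+ 2.
    have y0 : 0 <= y by exact: sqr_ge0.
    have -> : - y / ((2 * s) ^+ 2 *+ 2) = - y / (s ^+ 2 *+ 2) + 3 * y / (8 * s ^+ 2).
      by rewrite -[s ^+ 2 *+ 2]mulr_natr -[(2 * s) ^+ 2 *+ 2]mulr_natr; field.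
    rewrite expRD; set E := expR (- y / _).
    have E0 : 0 < E by exact: expR_gt0.
    have h := expR_ge1Dx (3 * y / (8 * s ^+ 2)); set F := expR _ in h *.
    have h2 : 3 * y <= 8 * s ^+ 2 * F.
      have : 3 * y / (8 * s ^+ 2) <= F by lra.
      have h3 : 0 < 8 * s ^+ 2 by rewrite mulr_gt0.
      by rewrite (ler_pdivrMr _ _ h3); lra.

    have -> : 8 * s ^+ 2 * (p / 2 * (E * F)) = (p * E) * ((8 * s ^+ 2 * F) / 2) by ring.
    rewrite [y * _]mulrC ler_pM2l ?mulr_gt0//; lra.
rewrite ge0_integralZl//; last first.
- by rewrite lee_fin mulr_ge0// ltW.
- by move=> x _; rewrite lee_fin normal_pdf_ge0.
- by apply/measurable_EFinP; exact: measurable_normal_pdf.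
by rewrite integral_normal_pdf mule1.
Qed.

(** The density of the law with parameters [m] and [s] is at most [1 / |s|], and
    [|s|] is at least [sg] because
    [8 * sg ^+ 2 <= E Y ^+ 2 <= E (Y - m) ^+ 2 <= 8 * s ^+ 2], the middle step
    using that [Y] is centred.  The same chain excludes the Dirac case. *)
Lemma gaussian_small_ball d (T : measurableType d) (R : realType)
    (P : probability T R) (Y : T -> R) (sg y0 delta : R) :
  measurable_fun [set: T] Y -> gaussian_rv P Y ->
  P.-integrable [set: T] (EFin \o Y) -> (\int[P]_w (Y w)%:E = 0)%E ->
  P.-integrable [set: T] (fun w => (Y w ^+ 2)%:E) ->
  ((8 * sg ^+ 2)%:E <= \int[P]_w (Y w ^+ 2)%:E)%E ->
  0 < sg -> 0 <= delta ->
  (P (Y @^-1` [set y | (`|y0 + y| < delta)%R]) <= (2 * delta / sg)%:E)%E.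
Proof.
move=> mY [m [s law]] iY EY iY2 var sg0 delta0.
(* normal_prob is a measure on the Borel structure MR of the line; Y' is Y seen
   as a map into MR, so that the law of Y can be compared with it. *)
pose MR := measurableTypeR R; pose Y' : T -> MR := Y.
have mY' : measurable_fun [set: T] Y' by exact: mY.
have msq : measurable_fun [set: MR] (fun y : MR => ((y - m) ^+ 2)%:E).
  by apply/measurable_EFinP; apply: measurable_funX; apply: measurable_funB.
have ZE w : ((Y w - m) ^+ 2)%:E =
    ((Y w ^+ 2)%:E + ((- (2 * m))%:E * (Y w)%:E + (m ^+ 2)%:E))%E.
  by rewrite -EFinM -!EFinD; congr EFin; ring.
have i1 : P.-integrable [set: T] (fun w => (- (2 * m))%:E * (Y w)%:E)%E.
  exact: integrableZl.
have i2 : P.-integrable [set: T] (fun w => (m ^+ 2)%:E).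
  exact: finite_measure_integrable_cst.
have i12 := integrableD measurableT i1 i2.
have iZ : P.-integrable [set: T] (fun w => ((Y w - m) ^+ 2)%:E).
  under eq_fun do rewrite ZE.
  exact: (integrableD measurableT iY2 i12).
have EZ : (\int[P]_w ((Y w - m) ^+ 2)%:E = \int[P]_w (Y w ^+ 2)%:E + (m ^+ 2)%:E)%E.
  under eq_integral do rewrite ZE.
  rewrite integralD// integralD// integralZl// EY mule0 add0e.
  by rewrite integral_cst//= probability_setT mule1.
have pushZ : (\int[P]_w ((Y w - m) ^+ 2)%:E =
    \int[pushforward P Y']_y ((y - m) ^+ 2)%:E)%E.
  rewrite ge0_integral_pushforward//.
  by move=> y _; rewrite lee_fin sqr_ge0.
have EZle : (\int[P]_w ((Y w - m) ^+ 2)%:E <= (8 * s ^+ 2)%:E)%E.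
  have [s0|s0] := eqVneq s 0.
    have lawD (A : set MR) : measurable A -> A `<=` [set: MR] ->
        pushforward P Y' A = dirac (m : MR) A.
      by move=> mA _; have := law A mA; rewrite s0 eqxx; exact.
    have lawInt (f : MR -> \bar R) :
        (\int[pushforward P Y']_y f y = \int[dirac (m : MR)]_y f y)%E.
      exact: (@eq_measure_integral _ _ _ _ (dirac (m : MR)) _ _ lawD).
    rewrite pushZ lawInt integral_dirac//= diracT mul1e subrr.
    by rewrite expr0n/= s0 expr0n/= mulr0.
  have lawN (A : set MR) : measurable A -> A `<=` [set: MR] ->
      pushforward P Y' A = normal_prob m s A.
    by move=> mA _; have := law A mA; rewrite (negbTE s0); exact.
  have lawInt (f : MR -> \bar R) :
      (\int[pushforward P Y']_y f y = \int[normal_prob m s]_y f y)%E.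
    exact: (@eq_measure_integral _ _ _ _ (normal_prob m s) _ _ lawN).
  rewrite pushZ lawInt.
  rewrite integral_normal_prob//; first exact: normal_second_moment_le.
  under eq_integral do rewrite gee0_abs ?lee_fin ?sqr_ge0//.
  rewrite -lawInt -pushZ.
  have /integrableP[_] := iZ.
  by under eq_integral do rewrite gee0_abs ?lee_fin ?sqr_ge0//.
have sgs : sg <= `|s|.
  rewrite -(@ler_pXn2r _ 2%N) ?nnegrE ?normr_ge0 ?(ltW sg0)//.
  rewrite real_normK ?num_real// -(@ler_pM2l _ 8)// -lee_fin.
  apply: le_trans var _; apply: le_trans EZle; rewrite EZ.
  by rewrite leeDl// lee_fin sqr_ge0.
have s0 : s != 0 by rewrite -normr_gt0 (lt_le_trans sg0).
have -> : [set y | `|y0 + y| < delta] = `] (- y0 - delta), (- y0 + delta) [%classic.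
  apply/seteqP; split => y /=; rewrite in_itv/= ltr_norml.
    by move=> /andP[? ?]; apply/andP; split; lra.
  by move=> /andP[? ?]; apply/andP; split; lra.
rewrite law ?(negbTE s0)//.
have peak : normal_peak s <= sg^-1.
  rewrite /normal_peak lef_pV2 ?posrE//; last first.
    by rewrite sqrtr_gt0 pmulrn_lgt0// mulr_gt0 ?pi_gt0// exprn_even_gt0.
  apply: le_trans sgs _; rewrite -sqrtr_sqr ler_sqrt; last first.
    by rewrite pmulrn_lge0// mulr_ge0 ?pi_ge0// sqr_ge0.
  rewrite -mulrnAr ler_peMr ?sqr_ge0//.
  have := @pi_ge2 R; rewrite mulr2n; lra.
apply: (@le_trans _ _ (\int[lebesgue_measure]_(x in `] (- y0 - delta)%R, (- y0 + delta)%R [) (cst (sg^-1)%:E x))%E).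
  apply: ge0_le_integral => //.
  - by move=> y _; rewrite lee_fin normal_pdf_ge0.
  - apply: measurable_funTS; apply/measurable_EFinP; exact: measurable_normal_pdf.
  - by move=> y _; rewrite lee_fin (le_trans (normal_pdf_ub _ _ s0)).
rewrite integral_cst//= lebesgue_measure_itv/=.
case: ifP => _; last by rewrite mule0 lee_fin divr_ge0 ?mulr_ge0// ltW.
rewrite -EFinB -EFinM lee_fin le_eqVlt; apply/orP; left; apply/eqP; ring.
Qed.

(** * Second moments of fractional Brownian motion *)

Definition fBm_cov_fun {R : realType} (H s t : R) : R :=
  2^-1 * (s `^ (2 * H) + t `^ (2 * H) - `|t - s| `^ (2 * H)).

Lemma fBm_cov_fun_le (R : realType) (H c s t : R) :
  0 < H -> H < 2^-1 -> 0 <= s <= c -> 0 <= t <= c ->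
  fBm_cov_fun H s t <= 1 + c.
Proof.
move=> H0 H1 /andP[s0 sc] /andP[t0 tc].
have pw x : 0 <= x <= c -> x `^ (2 * H) <= 1 + c.
  move=> /andP[x0 xc]; have [x1|x1] := leP 1 x.
    by apply: (@le_trans _ _ x); [apply: ler1_powR; lra|lra].
  apply: (@le_trans _ _ (1 `^ (2 * H))); last by rewrite powR1; lra.
  by apply: ge0_ler_powR; rewrite ?nnegrE; lra.
have := pw s; rewrite s0 sc => /(_ isT) h1.
have := pw t; rewrite t0 tc => /(_ isT) h2.
have := powR_ge0 `|t - s| (2 * H); rewrite /fBm_cov_fun; lra.
Qed.

Lemma fBm_cov_fun_sym (R : realType) (H s t : R) :
  fBm_cov_fun H s t = fBm_cov_fun H t s.
Proof. by rewrite /fBm_cov_fun distrC; congr (_ * (_ - _)); rewrite addrC. Qed.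

(** For [s <= t] the covariance is at least half of [s `^ (2 * H)], hence half of
    [min s 1] since [2 * H <= 1]; the factor in [s] is at most
    [alpha * min s 1], and the one in [t] is at most [1 <= alpha].  The exponential form of the
    factors is chosen for the explicit antiderivative in
    [left_riemann_expR_bump]. *)
Lemma fBm_cov_fun_ge (R : realType) (H alpha s t : R) :
  0 < H -> H < 2^-1 -> 1 <= alpha -> 0 <= s -> 0 <= t ->
  (1 - expR (- (alpha * s))) * (1 - expR (- (alpha * t))) / (2 * alpha ^+ 2)
    <= fBm_cov_fun H s t.
Proof.
move=> H0 H1 al1; wlog st : s t / s <= t.
  move=> wl s0 t0; have [/wl->//|/ltW ts] := leP s t.
  by rewrite fBm_cov_fun_sym [_ * (1 - _)]mulrC wl.
move=> s0 t0.
have g0 x : 0 <= x -> 0 <= 1 - expR (- (alpha * x)) <= 1.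
  move=> x0; have : expR (- (alpha * x)) <= 1.
    by rewrite expR_le1 oppr_le0 mulr_ge0//; lra.
  by have := expR_ge0 (- (alpha * x)); move=> ? ?; apply/andP; split; lra.
have gs : 1 - expR (- (alpha * s)) <= alpha * Num.min s 1.
  rewrite /Num.min; case: ifP => _.
    by have := expR_ge1Dx (- (alpha * s)); lra.
  by have /andP[_] := g0 s s0; lra.
have /andP[gs0 gs1] := g0 s s0; have /andP[gt0 gt1] := g0 t t0.
have ms : Num.min s 1 <= s `^ (2 * H).
  rewrite /Num.min; case: ltP => s1.
    have [->|sn0] := eqVneq s 0; first by rewrite powR0 ?gt_eqF//; lra.
    by apply: ger1_powR; [apply/andP; split; [rewrite lt_def sn0|lra]|lra].
  apply: (@le_trans _ _ (1 `^ (2 * H))); first by rewrite powR1.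
  by apply: ge0_ler_powR; rewrite ?nnegrE; lra.
have hK : 2^-1 * s `^ (2 * H) <= fBm_cov_fun H s t.
  rewrite /fBm_cov_fun ger0_norm ?subr_ge0//.
  have : (t - s) `^ (2 * H) <= t `^ (2 * H).
    by apply: ge0_ler_powR; rewrite ?nnegrE; lra.
  lra.
apply: le_trans hK.
have al0' : 0 < alpha by lra.
have al0 : 0 < alpha ^+ 2 by rewrite exprn_gt0//; lra.
rewrite ler_pdivrMr ?mulr_gt0//.
set p := s `^ (2 * H) in ms *; set mn := Num.min s 1 in gs ms.
have h1 : (1 - expR (- (alpha * s))) * (1 - expR (- (alpha * t))) <= alpha * mn.
  by apply: le_trans gs; rewrite ler_piMr.
apply: le_trans h1 _.
have -> : 2^-1 * p * (2 * alpha ^+ 2) = alpha * (alpha * p).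
  by field.
rewrite ler_pM2l//.
have p0 : 0 <= p by exact: powR_ge0.
apply: le_trans ms _; rewrite ler_peMl//.
Qed.

Lemma fBm_sqr_integrable d (T : measurableType d) (R : realType)
    (P : probability T R) (H : R) (B : R -> {RV P >-> R}) (t : R) :
  is_fBm P H B -> 0 <= t ->
  P.-integrable [set: T] (fun w => ((B t w) ^+ 2)%:E).
Proof.
move=> fB t0; apply/integrableP; split.
  by apply/measurable_EFinP; exact: measurable_funX.
under eq_integral do rewrite gee0_abs ?lee_fin ?sqr_ge0//.
have := fBm_cov fB t0 t0; rewrite unlock => cov.
rewrite (eq_integral (fun w => (B t w * B t w)%:E)) ?cov ?ltry//.
Qed.

Lemma fBm_mul_integrable d (T : measurableType d) (R : realType)
    (P : probability T R) (H : R) (B : R -> {RV P >-> R}) (s t : R) :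
  is_fBm P H B -> 0 <= s -> 0 <= t ->
  P.-integrable [set: T] (fun w => (B s w * B t w)%:E).
Proof.
move=> fB s0 t0.
have i2 := integrableD measurableT (fBm_sqr_integrable fB s0) (fBm_sqr_integrable fB t0).
apply: le_integrable i2 => //.
  by apply/measurable_EFinP; exact: measurable_funM.
move=> w _; rewrite /= lee_fin (@ger0_norm _ (_ + _)) ?addr_ge0 ?sqr_ge0//.
rewrite ler_norml; apply/andP; split.
  by have := sqr_ge0 (B s w + B t w); nra.
by have := sqr_ge0 (B s w - B t w); nra.
Qed.

Lemma fBm_integrable d (T : measurableType d) (R : realType)
    (P : probability T R) (H : R) (B : R -> {RV P >-> R}) (t : R) :
  is_fBm P H B -> 0 <= t -> P.-integrable [set: T] (EFin \o B t).
Proof.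
move=> fB t0.
have i1 : P.-integrable [set: T] (fun=> 1%:E) by exact: finite_measure_integrable_cst.
have i2 := integrableD measurableT i1 (fBm_sqr_integrable fB t0).
apply: le_integrable i2 => //.
  exact/measurable_EFinP.
move=> w _; rewrite /= lee_fin (@ger0_norm _ (_ + _)) ?addr_ge0 ?sqr_ge0//.
rewrite ler_norml; apply/andP; split; nra.
Qed.

Section fBm_linear_combination.
Context d (T : measurableType d) (R : realType) (P : probability T R) (H : R)
  (B : R -> {RV P >-> R}) (fB : is_fBm P H B)
  (n : nat) (t a : 'I_n -> R) (t_ge0 : forall i, 0 <= t i).

Let L w := \sum_(i < n) a i * B (t i) w.

Lemma fBm_comb_measurable : measurable_fun [set: T] L.
Proof. by apply: measurable_sum => i; exact: measurable_funM. Qed.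

Lemma fBm_comb_integrable : P.-integrable [set: T] (EFin \o L).
Proof.
rewrite /L /comp; under eq_fun do rewrite -sumEFin.
apply: integrable_sum => // i _; under eq_fun do rewrite EFinM.
by apply: integrableZl => //; exact: (fBm_integrable fB (t_ge0 _)).
Qed.

Lemma fBm_comb_mean : (\int[P]_w (L w)%:E = 0)%E.
Proof.
rewrite /L; under eq_integral do rewrite -sumEFin.
rewrite integral_sum//; last first.
  move=> i; under eq_fun do rewrite EFinM.
  by apply: integrableZl => //; exact: (fBm_integrable fB (t_ge0 _)).
rewrite big1// => i _; under eq_integral do rewrite EFinM.
rewrite integralZl//; last exact: (fBm_integrable fB (t_ge0 _)).
have := fBm_centered fB (t_ge0 i); rewrite unlock => ->.
by rewrite mule0.
Qed.

Let sqrLE w : ((L w) ^+ 2)%:E =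
  (\sum_(i < n) \sum_(l < n) (a i * a l)%:E * (B (t i) w * B (t l) w)%:E)%E.
Proof.
rewrite expr2 /L big_distrlr/= -sumEFin; apply: eq_bigr => i _.
rewrite -sumEFin; apply: eq_bigr => l _.
by rewrite -EFinM; congr EFin; ring.
Qed.

Let int_term i l : P.-integrable [set: T]
  (fun w => (a i * a l)%:E * (B (t i) w * B (t l) w)%:E)%E.
Proof. by apply: integrableZl => //; exact: (fBm_mul_integrable fB (t_ge0 _) (t_ge0 _)). Qed.

Lemma fBm_comb_sqr_integrable : P.-integrable [set: T] (fun w => ((L w) ^+ 2)%:E).
Proof.
under eq_fun do rewrite sqrLE.
by apply: integrable_sum => // i _; apply: integrable_sum => // l _.
Qed.

Lemma fBm_comb_second_moment :
  (\int[P]_w ((L w) ^+ 2)%:E =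
    (\sum_(i < n) \sum_(l < n) a i * a l * fBm_cov_fun H (t i) (t l))%:E)%E.
Proof.
under eq_integral do rewrite sqrLE.
rewrite integral_sum//; last by move=> i; apply: integrable_sum.
rewrite -sumEFin; apply: eq_bigr => i _.
rewrite integral_sum// -sumEFin; apply: eq_bigr => l _.
rewrite integralZl//; last exact: (fBm_mul_integrable fB (t_ge0 _) (t_ge0 _)).
have := fBm_cov fB (t_ge0 l) (t_ge0 i); rewrite unlock => ->.
by rewrite -EFinM fBm_cov_fun_sym.
Qed.

Hypothesis H_gt0 : 0 < H.
Hypothesis H_lt_half : H < 2^-1.
Hypothesis a_ge0 : forall i, 0 <= a i.

Lemma fBm_comb_second_moment_le c : (forall i, t i <= c) ->
  (\int[P]_w ((L w) ^+ 2)%:E <= ((\sum_(i < n) a i) ^+ 2 * (1 + c))%:E)%E.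
Proof.
move=> tc; rewrite fBm_comb_second_moment lee_fin expr2 big_distrlr/= mulr_suml.
apply: ler_sum => i _; rewrite mulr_suml; apply: ler_sum => l _.
apply: ler_wpM2l; first by rewrite mulr_ge0.
by apply: fBm_cov_fun_le; rewrite ?t_ge0 ?tc.
Qed.

(** The lower bound on the covariance factors, so the double sum is bounded
    below by a square, which nonnegative weights keep away from zero. *)
Lemma fBm_comb_second_moment_ge alpha : 1 <= alpha ->
  (((\sum_(i < n) a i * (1 - expR (- (alpha * t i)))) ^+ 2 / (2 * alpha ^+ 2))%:E
    <= \int[P]_w ((L w) ^+ 2)%:E)%E.
Proof.
move=> al1; rewrite fBm_comb_second_moment lee_fin expr2 big_distrlr/= mulr_suml.
apply: ler_sum => i _; rewrite mulr_suml; apply: ler_sum => l _.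
have := fBm_cov_fun_ge H_gt0 H_lt_half al1 (t_ge0 i) (t_ge0 l).
move=> /(ler_wpM2l (mulr_ge0 (a_ge0 i) (a_ge0 l))); apply: le_trans.
by rewrite le_eqVlt; apply/orP; left; apply/eqP; ring.
Qed.

End fBm_linear_combination.

(** * Tails and small balls of the drift *)

Lemma measurable_norm_ge d (T : measurableType d) (R : realType)
    (Y : T -> R) (lambda : R) :
  measurable_fun [set: T] Y -> measurable [set w | lambda <= `|Y w|].
Proof.
move=> mY; rewrite -[X in measurable X]setTI.
rewrite (_ : [set w | _] = (fun w => `|Y w|) @^-1` `[lambda, +oo[%classic).
  by apply: measurableT_comp mY _ _ _ => //; exact: measurable_itv.
by apply/seteqP; split => w; rewrite /= in_itv/= andbT.
Qed.

Lemma markov_second_moment d (T : measurableType d) (R : realType)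
    (P : probability T R) (Y : T -> R) (M lambda : R) :
  measurable_fun [set: T] Y -> (\int[P]_w (Y w ^+ 2)%:E <= M%:E)%E ->
  0 < lambda -> (P [set w | (lambda <= `|Y w|)%R] <= (M / lambda ^+ 2)%:E)%E.
Proof.
move=> mY YM l0; set E := [set w | _].
have mE : measurable E by exact: measurable_norm_ge.
have mY2 : measurable_fun [set: T] (fun w => (Y w ^+ 2)%:E).
  by apply/measurable_EFinP; exact: measurable_funX.
have l2 : 0 < lambda ^+ 2 by rewrite exprn_gt0.
have h : ((lambda ^+ 2)%:E * P E <= M%:E)%E.
  rewrite -integral_cst//; apply: le_trans YM.
  apply: (@le_trans _ _ (\int[P]_(w in E) (Y w ^+ 2)%:E)%E).
    apply: ge0_le_integral => //.
    - by move=> w _; rewrite lee_fin ltW.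
    - exact: measurable_funTS.
    - move=> w /= lw; rewrite lee_fin -[leRHS]real_normK ?num_real//.
      by rewrite lerXn2r ?nnegrE ?normr_ge0// ltW.
  by apply: ge0_subset_integral => // w _; rewrite lee_fin sqr_ge0.
by rewrite mulrC EFinM lee_pdivlMl.
Qed.

(** An antiderivative of the summand is
    [expR (- (2 * alpha * s)) / (2 * alpha) - expR (- (alpha * s)) / alpha]. *)
Lemma left_riemann_expR_bump (R : realType) (alpha t : R) :
  0 < alpha -> 0 < t ->
  left_riemann (fun s => expR (- (alpha * s)) * (1 - expR (- (alpha * s)))) 0 t j
    @[j --> \oo] --> (1 - expR (- (alpha * t))) ^+ 2 / (2 * alpha).
Proof.
move=> al0 t0.
pose E1 (s : R) := expR (alpha * (0 - s)).
pose E2 (s : R) := expR (2 * alpha * (0 - s)).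
have E1E s : E1 s = expR (- (alpha * s)) by rewrite /E1 sub0r mulrN.
have E2E s : E2 s = E1 s ^+ 2.
  by rewrite /E2 /E1 -expRM_natl; congr expR; ring.
have dF (s : R) : is_derive s 1 ((2 * alpha)^-1 \*: E2 - alpha^-1 \*: E1)
    (expR (- (alpha * s)) * (1 - expR (- (alpha * s)))).
  apply: (is_derive_eq (is_deriveB
    (is_deriveZ _ (is_derive_expR_decay (2 * alpha) 0 s))
    (is_deriveZ _ (is_derive_expR_decay alpha 0 s)))).
  rewrite -/(E1 s) -/(E2 s) E2E -E1E /GRing.scale/=.
  by field; rewrite gt_eqF.
have -> : (1 - expR (- (alpha * t))) ^+ 2 / (2 * alpha) =
    ((2 * alpha)^-1 \*: E2 - alpha^-1 \*: E1) t -
    ((2 * alpha)^-1 \*: E2 - alpha^-1 \*: E1) 0.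
  rewrite !fctE /= !E2E !E1E mulr0 oppr0 expR0 /GRing.scale/=.
  by field; rewrite gt_eqF.
apply: left_riemann_cvg => //.
- have cE : continuous (fun s : R => expR (- (alpha * s))).
    move=> s; apply: continuous_comp; last exact: continuous_expR.
    by apply: cvgN; apply: cvgM; [exact: cvg_cst|exact: cvg_id].
  move=> s; apply: cvgM; first exact: cE.
  by apply: cvgB; [exact: cvg_cst|exact: cE].
- apply: derivable_within_continuous => s _; exact: (@ex_derive _ _ _ _ _ _ _ (dF s)).
Qed.

Definition node {R : realType} (a c : R) (j : nat) (i : 'I_j.+1) : R :=
  a + i%:R * ((c - a) / j.+1%:R).

(** The coefficients of [B] in the Riemann sums of [ou_drift_riemann]. *)
Definition drift_weight {R : realType} (theta a c : R) (j : nat) (i : 'I_j.+1) : R :=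
  (c - a) / j.+1%:R * (theta * expR (theta * (c - node a c i))).

Lemma node_bounds (R : realType) (a c : R) (j : nat) (i : 'I_j.+1) :
  a <= c -> a <= node a c i <= c.
Proof.
move=> ac; have j0 : 0 < j.+1%:R :> R by rewrite ltr0n.
have h0 : 0 <= (c - a) / j.+1%:R by rewrite divr_ge0 ?subr_ge0// ltW.
rewrite lerDl mulr_ge0 ?ler0n//= /node -lerBrDl.
rewrite -[leRHS](@divfK _ j.+1%:R) ?gt_eqF// mulrC ler_wpM2l//.
by rewrite ler_nat ltnW.
Qed.

Lemma drift_weight_ge0 (R : realType) (theta a c : R) (j : nat) (i : 'I_j.+1) :
  0 <= theta -> a <= c -> 0 <= drift_weight theta a c i.
Proof.
move=> t0 ac.
by rewrite !mulr_ge0 ?expR_ge0 ?subr_ge0// invr_ge0.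
Qed.

Lemma drift_weight_sum_le (R : realType) (theta a c : R) (j : nat) :
  0 <= theta -> a <= c -> c - a <= 1 ->
  \sum_(i < j.+1) drift_weight theta a c i <= theta * expR theta.
Proof.
move=> t0 ac ca; have j0 : 0 < j.+1%:R :> R by rewrite ltr0n.
have te : 0 <= theta * expR theta by rewrite mulr_ge0 ?expR_ge0.
apply: (@le_trans _ _ (\sum_(i < j.+1) (c - a) / j.+1%:R * (theta * expR theta))).
  apply: ler_sum => i _; apply: ler_wpM2l.
    by rewrite divr_ge0 ?subr_ge0// ltW.
  apply: ler_wpM2l => //; rewrite ler_expR.
  by have /andP[? ?] := node_bounds i ac; rewrite ler_piMr//; lra.
rewrite sumr_const card_ord -[leLHS]mulr_natl mulrA [j.+1%:R * _]mulrC.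
by rewrite divfK ?gt_eqF// ler_piMl.
Qed.

Lemma drift_sum_cvg d (T : measurableType d) (R : realType)
    (P : probability T R) (theta x0 a c : R) (B X : R -> {RV P >-> R}) (w : T) :
  ou_path theta x0 (fun t => X t w) (fun t => B t w) -> 0 <= a -> a < c ->
  \sum_(i < j.+1) drift_weight theta a c i * B `|node a c i| w @[j --> \oo]
    --> (X c w - B c w) - expR (theta * (c - a)) * (X a w - B a w).
Proof.
move=> pw a0 ac; apply: cvg_trans (ou_drift_riemann pw a0 ac).
apply: near_eq_cvg; apply: nearW => j; rewrite /left_riemann.
by apply: eq_bigr => i _; rewrite mulrA.
Qed.

(** The Riemann sums have a second moment bounded uniformly in the mesh, so
    Markov's inequality applies to each of them and survives the limit. *)
Lemma drift_outer_le d (T : measurableType d) (R : realType)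
    (P : probability T R) (H theta x0 a c lambda : R) (B X : R -> {RV P >-> R}) :
  is_fBm P H B -> 0 < H -> H < 2^-1 -> 0 <= theta ->
  0 <= a -> a < c -> c - a <= 1 -> 0 < lambda ->
  outer_le P [set w | ou_path theta x0 (fun t => X t w) (fun t => B t w) /\
    lambda < `|(X c w - B c w) - expR (theta * (c - a)) * (X a w - B a w)|]
    ((theta * expR theta) ^+ 2 * (1 + c) / lambda ^+ 2).
Proof.
move=> fB H0 H1 t0 a0 ac ca l0.
have ac' := ltW ac.
pose L j w := \sum_(i < j.+1) drift_weight theta a c i * B `|node a c i| w.
have mL j : measurable_fun [set: T] (L j) by exact: fBm_comb_measurable.
have mE j : measurable [set w | lambda <= `|L j w|] by exact: measurable_norm_ge.
apply: (@outer_le_liminf _ _ _ _ _ (fun j => [set w | lambda <= `|L j w|])) => //.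
  apply: nearW => j; apply: markov_second_moment => //.
  apply: le_trans (fBm_comb_second_moment_le fB _ H0 H1 _ (c := c) _) _.
  - by move=> i; exact: normr_ge0.
  - by move=> i; exact: drift_weight_ge0.
  - move=> i; have /andP[? ?] := node_bounds i ac'.
    by rewrite ger0_norm//; lra.
  rewrite lee_fin ler_wpM2r//; first by lra.
  rewrite lerXn2r ?nnegrE//.
  - by apply: sumr_ge0 => i _; exact: drift_weight_ge0.
  - by rewrite mulr_ge0 ?expR_ge0.
  - exact: drift_weight_sum_le.
move=> w [pw lw].
have cv : `|L j w| @[j --> \oo] -->
    `|(X c w - B c w) - expR (theta * (c - a)) * (X a w - B a w)|.
  by apply: cvg_norm; exact: (drift_sum_cvg pw a0 ac).
have ev : \forall j \near \oo, lambda < `|L j w|.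
  by move/cvgr_gt : cv; apply.
near=> j; apply: ltW.
by near: j; exact: ev.
Unshelve. all: by end_near.
Qed.

Lemma fBm_outer_le d (T : measurableType d) (R : realType)
    (P : probability T R) (H t lambda : R) (B : R -> {RV P >-> R}) :
  is_fBm P H B -> 0 < H -> H < 2^-1 -> 0 <= t -> 0 < lambda ->
  outer_le P [set w | lambda < `|B t w|] ((1 + t) / lambda ^+ 2).
Proof.
move=> fB H0 H1 t0 l0; exists [set w | lambda <= `|B t w|]; split.
- exact: measurable_norm_ge.
- by move=> w /= /ltW.
- apply: markov_second_moment => //.
  have := fBm_cov fB t0 t0; rewrite unlock => cov.
  rewrite (eq_integral (fun w => (B t w * B t w)%:E)) ?cov//.
  by rewrite lee_fin; apply: fBm_cov_fun_le; rewrite ?t0 ?lexx.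
Qed.

(** Raising the rate from [theta] to [theta + 1] only decreases the exponential,
    and makes the rate at least 1, as [fBm_cov_fun_ge] requires. *)
Lemma drift_weight_bump_sum_ge (R : realType) (theta t : R) (j : nat) :
  0 < theta -> 0 < t ->
  theta * expR (theta * t) * left_riemann (fun s =>
    expR (- ((theta + 1) * s)) * (1 - expR (- ((theta + 1) * s)))) 0 t j <=
  \sum_(i < j.+1) drift_weight theta 0 t i *
    (1 - expR (- ((theta + 1) * `|node 0 t i|))).
Proof.
move=> th0 t0; rewrite /left_riemann mulr_sumr; apply: ler_sum => i _.
have /andP[n0 nt] := node_bounds i (ltW t0).
rewrite -/(node 0 t i) (ger0_norm n0) /drift_weight.
set s := node 0 t i in n0 nt *; set h := (t - 0) / _.
have h0 : 0 <= h by rewrite /h subr0 divr_ge0// ltW.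
have g0 : 0 <= 1 - expR (- ((theta + 1) * s)).
  by rewrite subr_ge0 expR_le1 oppr_le0 mulr_ge0//; lra.
have -> : theta * (t - s) = theta * t + - (theta * s) by ring.
rewrite expRD; set g := 1 - _ in g0 *; set E := expR (theta * t).
have E0 : 0 < E by exact: expR_gt0.
have es : expR (- ((theta + 1) * s)) <= expR (- (theta * s)) by rewrite ler_expR; lra.
have -> : theta * E * (h * (expR (- ((theta + 1) * s)) * g)) =
    (theta * E * h * g) * expR (- ((theta + 1) * s)) by ring.
have -> : h * (theta * (E * expR (- (theta * s)))) * g =
    (theta * E * h * g) * expR (- (theta * s)) by ring.
apply: ler_wpM2l es; rewrite mulr_ge0// mulr_ge0// mulr_ge0//; exact: ltW.
Qed.

(** The Riemann sums for the drift over [[0, t]] are Gaussian with standard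
    deviation at least a multiple of [expR (theta * t)]: in the lower bound on
    their second moment the weighted sum is itself a Riemann sum of
    [left_riemann_expR_bump], whose limit increases with [t].  The shift of the
    centre by [expR (theta * t) * x0] does not affect a small ball bound. *)
Lemma drift_small_ball (R : realType) (theta : R) : 0 < theta ->
  exists2 K, 0 < K & forall d (T : measurableType d) (P : probability T R)
    (H x0 t mu : R) (B X : R -> {RV P >-> R}),
  is_fBm P H B -> 0 < H -> H < 2^-1 -> 1 <= t -> 0 <= mu ->
  outer_le P [set w | ou_path theta x0 (fun t => X t w) (fun t => B t w) /\
    `|X t w - B t w| < mu] (K * mu * expR (- (theta * t))).
Proof.
move=> th0; pose alpha := theta + 1.
have al1 : 1 <= alpha by rewrite /alpha; lra.
have al0 : 0 < alpha by lra.
pose kappa := (1 - expR (- alpha)) ^+ 2 / (2 * alpha).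
have ea : expR (- alpha) < 1 by rewrite expR_lt1 oppr_lt0.
have ka0 : 0 < kappa.
  by apply: divr_gt0; [rewrite exprn_gt0// subr_gt0|rewrite mulr_gt0].
exists (16 * alpha / (theta * kappa)).
  by apply: divr_gt0; apply: mulr_gt0.
move=> d T P H x0 t mu B X fB H0 H1 t1 mu0.
have t0 : 0 < t by lra.
pose L j w := \sum_(i < j.+1) drift_weight theta 0 t i * B `|node 0 t i| w.
have mL j : measurable_fun [set: T] (L j) by exact: fBm_comb_measurable.
pose y0 := expR (theta * t) * x0.
pose E j := [set w | `|y0 + L j w| < mu].
have mE j : measurable (E j).
  rewrite (_ : E j = ~` [set w | mu <= `|y0 + L j w|]).
    by apply: measurableC; apply: measurable_norm_ge; exact: measurable_funD.
  apply/seteqP; split => w; rewrite /E /= ltNge; first by move/negP.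
  by move=> ?; apply/negP.
apply: (@outer_le_liminf _ _ _ _ _ E) => //; last first.
  move=> w [pw Vw]; rewrite /E/=.
  have cv : `|y0 + L j w| @[j --> \oo] --> `|X t w - B t w|.
    have -> : X t w - B t w =
        y0 + ((X t w - B t w) - expR (theta * (t - 0)) * (X 0 w - B 0 w)).
      by rewrite (ou_path_start pw) subr0 /y0; ring.
    apply: cvg_norm; apply: cvgD; first exact: cvg_cst.
    exact: (drift_sum_cvg pw (lexx 0) t0).
  by move/cvgr_lt : cv; apply.
pose bump s := expR (- (alpha * s)) * (1 - expR (- (alpha * s))).
have cvb := left_riemann_expR_bump al0 t0.
have limge : kappa / 2 < (1 - expR (- (alpha * t))) ^+ 2 / (2 * alpha).
  apply: (@lt_le_trans _ _ kappa); first lra.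
  rewrite ler_pM2r ?invr_gt0 ?mulr_gt0// lerXn2r ?nnegrE ?subr_ge0 ?(ltW ea)//.
    by rewrite expR_le1 oppr_le0 mulr_ge0//; lra.
  by rewrite lerB// ler_expR lerN2 ler_peMr//; lra.
have evb : \forall j \near \oo, kappa / 2 < left_riemann bump 0 t j.
  by move/cvgr_gt : cvb; apply.
near=> j.
have hb : kappa / 2 < left_riemann bump 0 t j by near: j; exact: evb.
(* sg is scaled so that 8 sg^2 is the second moment bound obtained from the
   half-limit kappa / 2 of the Riemann sums. *)
pose sg := theta * expR (theta * t) * kappa / (8 * alpha).
have e0 := expR_gt0 (theta * t).
have sg0 : 0 < sg.
  by apply: divr_gt0; apply: mulr_gt0 => //; exact: mulr_gt0.
have -> : 16 * alpha / (theta * kappa) * mu * expR (- (theta * t)) = 2 * mu / sg.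
  by rewrite /sg expRN; field; rewrite !gt_eqF.
have t_ge0 (i : 'I_j.+1) : 0 <= `|node 0 t i| by exact: normr_ge0.
apply: (@gaussian_small_ball _ _ _ _ (L j) sg y0 mu) => //.
- exact: (fBm_gaussian fB).
- exact: (fBm_comb_integrable fB).
- exact: (fBm_comb_mean fB).
- exact: (fBm_comb_sqr_integrable fB).
- apply: le_trans (fBm_comb_second_moment_ge fB t_ge0 H0 H1 _ al1); last first.
    by move=> i; apply: drift_weight_ge0; lra.
  have hs := drift_weight_bump_sum_ge j th0 t0.
  rewrite -/alpha -/bump in hs.
  set Sg := \sum_(i < j.+1) _ in hs *.
  have hS : theta * expR (theta * t) * (kappa / 2) <= Sg.
    by apply: le_trans hs; rewrite ler_pM2l ?mulr_gt0// ltW.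
  rewrite lee_fin ler_pdivlMr ?mulr_gt0 ?exprn_gt0//.
  have -> : 8 * sg ^+ 2 * (2 * alpha ^+ 2) = (theta * expR (theta * t) * (kappa / 2)) ^+ 2.
    by rewrite /sg; field; rewrite gt_eqF.
  have q0 : 0 <= theta * expR (theta * t) * (kappa / 2).
    apply: mulr_ge0; first by apply: mulr_ge0; exact: ltW.
    by apply: divr_ge0 => //; exact: ltW.
  by rewrite lerXn2r ?nnegrE// (le_trans q0).
Unshelve. all: by end_near. Qed.

(** * Almost sure consistency *)

(** At most [n ^ m + 1] times, each at most [n ^ m], and the level [n ^ (m + 1)]
    gains a factor [n ^- 2] on the square of that number. *)
Lemma grid_noise_outer_le d (T : measurableType d) (R : realType)
    (P : probability T R) (H : R) (B : R -> {RV P >-> R}) (m n : nat) :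
  is_fBm P H B -> 0 < H -> H < 2^-1 -> (0 < n)%N ->
  outer_le P (\bigcup_(k < (n ^ m).+1)
      [set w | n%:R ^+ m.+1 < `|B (k%:R / n%:R) w|])
    (4 / n%:R ^+ 2).
Proof.
move=> fB H0 H1 n0; have n0' : 0 < n%:R :> R by rewrite ltr0n.
have n1 : 1 <= n%:R :> R by rewrite ler1n.
have N1 : 1 <= n%:R ^+ m :> R by rewrite exprn_ege1.
pose e := (1 + n%:R ^+ m) / (n%:R ^+ m.+1) ^+ 2 : R.
have l0 : 0 < n%:R ^+ m.+1 :> R by rewrite exprn_gt0.
apply: (@outer_leW _ _ _ _ _ ((n ^ m).+1%:R * e)); last first.
  apply: outer_le_bigcup => k kN.
  have k0 : 0 <= k%:R / n%:R :> R by rewrite divr_ge0.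
  apply: outer_leW _ (fBm_outer_le fB H0 H1 k0 l0) => //.
  rewrite /e ler_pM2r ?invr_gt0 ?exprn_gt0// lerD2l ler_pdivrMr//.
  apply: (@le_trans _ _ (n%:R ^+ m)); last by rewrite ler_peMr// ltW// (lt_le_trans _ N1).
  by rewrite -natrX ler_nat.
rewrite /e -natr1 natrX [n%:R ^+ m.+1]exprS.
have := N1; set v := n%:R ^+ m => v1.
have v0 : 0 < v by lra.
rewrite ler_pdivlMr ?exprn_gt0//.
have -> : (v + 1) * ((1 + v) / (n%:R * v) ^+ 2) * n%:R ^+ 2 = ((1 + v) / v) ^+ 2.
  by field; rewrite !gt_eqF.
rewrite (_ : 4 = 2 ^+ 2); last by ring.
rewrite lerXn2r ?nnegrE//; first by rewrite divr_ge0//; lra.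
by rewrite ler_pdivrMr//; lra.
Qed.

Lemma grid_drift_outer_le d (T : measurableType d) (R : realType)
    (P : probability T R) (H theta x0 : R) (B X : R -> {RV P >-> R}) (m n : nat) :
  is_fBm P H B -> 0 < H -> H < 2^-1 -> 0 <= theta -> (0 < n)%N ->
  outer_le P (\bigcup_(k < n ^ m)
      [set w | ou_path theta x0 (fun t => X t w) (fun t => B t w) /\
         n%:R ^+ m.+1 <
           `|(X (k.+1%:R / n%:R) w - B (k.+1%:R / n%:R) w) -
             expR (theta * (k.+1%:R / n%:R - k%:R / n%:R)) *
               (X (k%:R / n%:R) w - B (k%:R / n%:R) w)|])
    (2 * (theta * expR theta) ^+ 2 / n%:R ^+ 2).
Proof.
move=> fB H0 H1 th0 n0; have n0' : 0 < n%:R :> R by rewrite ltr0n.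
have n1 : 1 <= n%:R :> R by rewrite ler1n.
have N1 : 1 <= n%:R ^+ m :> R by rewrite exprn_ege1.
pose D := (theta * expR theta) ^+ 2.
have D0 : 0 <= D by exact: sqr_ge0.
pose e := D * (1 + n%:R ^+ m) / (n%:R ^+ m.+1) ^+ 2 : R.
have l0 : 0 < n%:R ^+ m.+1 :> R by rewrite exprn_gt0.
apply: (@outer_leW _ _ _ _ _ ((n ^ m)%:R * e)); last first.
  apply: outer_le_bigcup => k kN.
  have k0 : 0 <= k%:R / n%:R :> R by rewrite divr_ge0.
  have dk : k.+1%:R / n%:R - k%:R / n%:R = n%:R^-1 :> R by rewrite -natr1; ring.
  have ac : k%:R / n%:R < k.+1%:R / n%:R :> R by rewrite -subr_gt0 dk invr_gt0.
  have ca : k.+1%:R / n%:R - k%:R / n%:R <= 1 :> R by rewrite dk invf_le1.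
  apply: outer_leW (drift_outer_le x0 X fB H0 H1 th0 k0 ac ca l0).
  rewrite /e ler_pM2r ?invr_gt0 ?exprn_gt0// ler_wpM2l// lerD2l ler_pdivrMr//.
  apply: (@le_trans _ _ (n%:R ^+ m)); last by rewrite ler_peMr// ltW// (lt_le_trans _ N1).
  by rewrite -natrX ler_nat.
rewrite /e natrX [n%:R ^+ m.+1]exprS -/D.
have := N1; set v := n%:R ^+ m => v1.
have v0 : 0 < v by lra.
rewrite ler_pdivlMr ?exprn_gt0//.
have -> : v * (D * (1 + v) / (n%:R * v) ^+ 2) * n%:R ^+ 2 = D * ((1 + v) / v).
  by field; rewrite !gt_eqF.
rewrite mulrC ler_wpM2r// ler_pdivrMr//; lra.
Qed.

(** Since [1 < m], the last observation time is at least [n - 1], so the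
    exponential decays in [n] and absorbs all the powers. *)
Lemma small_ball_rate (R : realType) (theta K c : R) (m : nat) :
  0 < theta -> 0 < K -> 0 <= c -> (1 < m)%N ->
  \forall n \near \oo,
    1 <= (n ^ m).-1%:R / n%:R :> R /\
    K * (n%:R ^+ m.+1 + c * n%:R ^+ (2 * m + 3)) *
      expR (- (theta * ((n ^ m).-1%:R / n%:R))) <= 1 / n%:R ^+ 2.
Proof.
move=> th0 K0 c0 m1; near=> n.
have n2 : (1 < n)%N by near: n; exact: nbhs_infty_gt.
have hexp : K * (1 + c) * expR theta * n%:R ^+ (2 * m + 5) <= expR (theta * n%:R).
  by near: n; exact: exp_dominates_poly.
have n0' : 0 < n%:R :> R by rewrite ltr0n ltnW.
have n1 : 1 <= n%:R :> R by rewrite ler1n ltnW.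
have Tge : n%:R - 1 <= (n ^ m).-1%:R / n%:R :> R.
  have -> : n%:R - 1 = n.-1%:R :> R.
    by rewrite -[in LHS](prednK (ltnW n2)) -natr1 addrK.
  rewrite ler_pdivlMr// -natrM ler_nat.
  have : (n ^ 2 <= n ^ m)%N by rewrite leq_exp2l.
  by rewrite expnS expn1; nia.
have h2 : 2 <= n%:R :> R by rewrite ler_nat.
split; first by lra.
rewrite ler_pdivlMr ?exprn_gt0// expRN.
set t := _ / _ in Tge *.
rewrite mulrAC ler_pdivrMr ?expR_gt0// mul1r.
have e1 : expR (theta * n%:R) <= expR theta * expR (theta * t).
  by rewrite -expRD ler_expR; nra.
have e0 := expR_gt0 theta.
rewrite -(ler_pM2l e0); apply: le_trans e1; apply: le_trans hexp.
have -> : K * (1 + c) * expR theta * n%:R ^+ (2 * m + 5) =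
    expR theta * (K * ((1 + c) * n%:R ^+ (2 * m + 3)) * n%:R ^+ 2).
  by rewrite (_ : (2 * m + 5 = (2 * m + 3) + 2)%N) 1?exprD; [ring|lia].
rewrite ler_pM2l// ler_wpM2r ?exprn_ge0 ?(ltW n0')// ler_pM2l//.
rewrite mulrDl mul1r lerD2r ler_weXn2l//; lia.
Unshelve. all: by end_near. Qed.

Unset Implicit Arguments.

Theorem theorem5p1 (R : realType) (d : measure_display) (T : measurableType d)
  (P : probability T R) (P_complete : measure_is_complete P)
  (H x0 theta : R) (H_gt0 : 0 < H) (H_lt_half : H < 2^-1) (theta_gt0 : 0 < theta)
  (B X : R -> {RV P >-> R})
  (B_fBm : is_fBm P H B) (X_fOU : is_fOU P theta x0 B X)
  (m : nat) (m_gt1 : (1 < m)%N) :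
  {ae P, forall w, theta_hat m n (fun t => X t w) @[n --> \oo] --> theta}.
Proof.
have [K K0 small] := drift_small_ball theta_gt0.
pose good w := ou_path theta x0 (fun t => X t w) (fun t => B t w).
pose c := 2 + expR theta.
have e0 := expR_gt0 theta.
have c0 : 0 < c by rewrite /c; lra.
pose D (a s : R) w := (X s w - B s w) - expR (theta * (s - a)) * (X a w - B a w).
pose lam n : R := n%:R ^+ m.+1.
pose mu n : R := lam n + c * n%:R ^+ (2 * m + 3).
pose last_t n : R := (n ^ m).-1%:R / n%:R.
(* The bad events: a large value of the noise on the grid, a large drift over
   one step, a drift at the last observation time too close to zero. *)
pose A1 n := \bigcup_(k < (n ^ m).+1) [set w | lam n < `|B (k%:R / n%:R) w|].
pose A2 n := \bigcup_(k < n ^ m)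
  [set w | good w /\ lam n < `|D (k%:R / n%:R) (k.+1%:R / n%:R) w|].
pose A3 n := [set w | good w /\ `|X (last_t n) w - B (last_t n) w| < mu n].
have bc : {ae P, forall w, \forall n \near \oo, ~ (A1 n `|` A2 n `|` A3 n) w}.
  apply: (@borel_cantelli _ _ _ _ _ (4 + 2 * (theta * expR theta) ^+ 2 + 1)).
  near=> n.
  have n0 : (0 < n)%N by near: n; exact: nbhs_infty_gt.
  have [t1 rate] : 1 <= last_t n /\
      K * mu n * expR (- (theta * last_t n)) <= 1 / n%:R ^+ 2.
    by near: n; exact: (small_ball_rate theta_gt0 K0 (ltW c0) m_gt1).
  have mu0 : 0 <= mu n.
    by rewrite addr_ge0 ?mulr_ge0 ?exprn_ge0// ltW.
  rewrite mulrDl mulrDl; apply: outer_leU; first apply: outer_leU.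
  - exact: (grid_noise_outer_le m B_fBm H_gt0 H_lt_half n0).
  - exact: (grid_drift_outer_le x0 X m B_fBm H_gt0 H_lt_half (ltW theta_gt0) n0).
  - exact: (outer_leW rate (small _ _ _ _ _ _ _ _ _ B_fBm H_gt0 H_lt_half t1 mu0)).
have ae_good : {ae P, forall w, good w}.
  have aeB := fBm_continuous B_fBm.
  by apply: filterS2 aeB X_fOU.
apply: filterS2 ae_good bc => w gw Aw.
apply: (theta_hat_cvg theta_gt0 c0).
- near=> n => k kN.
  have nA : ~ (A1 n `|` A2 n `|` A3 n) w by near: n; exact: Aw.
  have n0 : (0 < n)%N by near: n; exact: nbhs_infty_gt.
  have n0' : 0 < n%:R :> R by rewrite ltr0n.
  have hB i : (i <= n ^ m)%N -> `|B (i%:R / n%:R) w| <= lam n.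
    move=> iN; rewrite leNgt; apply/negP => h; apply: nA; left; left.
    by exists i.
  have hD : `|D (k%:R / n%:R) (k.+1%:R / n%:R) w| <= lam n.
    rewrite leNgt; apply/negP => h; apply: nA; left; right.
    by exists k.
  have hB0 := hB k (ltnW kN); have hB1 := hB k.+1 kN.
  have dk : k.+1%:R / n%:R - k%:R / n%:R = n%:R^-1 :> R by rewrite -natr1; ring.
  rewrite /D dk in hD; set q := expR (theta / n%:R) in hD *.
  set u := X _ w in hD *; set v := X _ w in hD *.
  set bu := B _ w in hB1 hD; set bv := B _ w in hB0 hD.
  have q0 : 0 < q by exact: expR_gt0.
  have qe : q <= expR theta.
    by rewrite ler_expR ler_pdivrMr// ler_peMr ?ler1n// ltW.
  have -> : u - q * v = (u - bu - q * (v - bv)) + bu - q * bv by ring.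
  have l0 : 0 <= lam n by exact: le_trans hB0.
  have hq : `|q * bv| <= expR theta * lam n.
    by rewrite normrM gtr0_norm//; apply: ler_pM => //; exact: ltW.
  rewrite /c -/(lam n).
  have := ler_normB (u - bu - q * (v - bv) + bu) (q * bv).
  have := ler_normD (u - bu - q * (v - bv)) bu.
  lra.
- near=> n.
  have nA : ~ (A1 n `|` A2 n `|` A3 n) w by near: n; exact: Aw.
  have hB : `|B (last_t n) w| <= lam n.
    rewrite leNgt; apply/negP => h; apply: nA; left; left.
    by exists (n ^ m).-1 => //=; rewrite ltnS leq_pred.
  have hV : mu n <= `|X (last_t n) w - B (last_t n) w|.
    by rewrite leNgt; apply/negP => h; apply: nA; right.
  have := ler_normB (X (last_t n) w) (B (last_t n) w).
  by move: hV; rewrite /mu -/(last_t n); lra.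
Unshelve. all: by end_near. Qed.
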